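(* Let $(X,\mathcal U)$ be a quasi-uniform space whose quasi-uniformity is generated by an $F$-quasi-gauge $D$ (i.e. $\mathcal U=\mathcal U_D$). Suppose that $\varphi:X\to\mathbb R\cup\{\infty\}$ is proper, bounded below, and that for every $x\in X$ the set $$S_\varphi(x)=\{y\in X:\varphi(y)+d(y,x)\le\varphi(x)\ \text{ for all } d\in D\}$$ is sequentially $\mathcal U$-closed. Suppose further that $(X,\mathcal U)$ is sequentially right $K$-complete, that the topology $\tau(\mathcal U)$ is $T_1$, and that $F:X\rightrightarrows X$ is a set-valued mapping with nonempty values. 1. If for every $x\in X$ there exists $y\in F(x)$ such that $\varphi(y)+d(y,x)\le\varphi(x)$ for all $d\in D$, then $F$ has a fixed point in $X$, i.e. there exists $z\in X$ such that $z\in F(z)$. 2. If for every $x\in X$, every $y\in F(x)$ and every $d\in D$ one has $\varphi(y)+d(y,x)\le\varphi(x)$, then $F$ has a stationary point in $X$, i.e. there exists $z\in X$ such that $F(z)=\{z\}$.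
   Context: A quasi-uniformity on a set $X$ is a nonempty family $\mathcal U$ of subsets of $X\times X$ which contain the diagonal, closed under supersets and finite intersections, such that for every $U\in\mathcal U$ there is $V\in\mathcal U$ with $V\circ V\subseteq U$, where $M\circ N=\{(x,z):\exists y,\ (x,y)\in M,\ (y,z)\in N\}$. The topology $\tau(\mathcal U)$ has $\{U(x):U\in\mathcal U\}$, $U(x)=\{y\in X:(x,y)\in U\}$, as neighborhood basis at $x$. An $F$-quasi-gauge on $X$ is a family $D$ of functions $d:X\times X\to\mathbb R$ such that: (QF1) $D$ is directed upward (for the pointwise order); (QF2) $d(x,y)\ge 0$ and $d(x,x)=0$ for all $d\in D$, $x,y\in X$; (QF3) for every $d\in D$ there is $d'\in D$ with $d'\ge d$ such that $d(x,y)\le d'(x,z)+d'(z,y)$ for all $x,y,z\in X$. It generates the quasi-uniformity $\mathcal U_D$ having as basis the sets $V_{d,\varepsilon}=\{(x,y)\in X\times X: d(x,y)<\varepsilon\}$, $d\in D$, $\varepsilon>0$. A sequence $(x_n)$ is right $K$-Cauchy if for every $U\in\mathcal U$ there is $n_U\in\mathbb N$ such that $(x_{n+k},x_n)\in U$ for all $n\ge n_U$ and all $k\in\mathbb N$. $(X,\mathcal U)$ is sequentially right $K$-complete if every right $K$-Cauchy sequence is $\tau(\mathcal U)$-convergent to some point of $X$. A set is sequentially $\mathcal U$-closed if it contains every $\tau(\mathcal U)$-limit of every sequence of its elements. $\varphi$ is proper if $\{x:\varphi(x)<\infty\}\neq\emptyset$. *)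

(* Defs.v *)
From HB Require Import structures.
From mathcomp Require Import all_boot all_order all_algebra.
From mathcomp Require Import all_classical all_reals all_analysis.

Set Implicit Arguments.
Unset Strict Implicit.
Unset Printing Implicit Defensive.

Import Order.TTheory GRing.Theory Num.Theory.
Import numFieldNormedType.Exports.

Local Open Scope classical_set_scope.
Local Open Scope relation_scope.
Local Open Scope ring_scope.

(* Same axioms as uniformType, minus stability under inversion.
   Here [nbhs_ qentourage x] is generated by the sets [set y | U (x, y)]. *)
HB.mixin Record Nbhs_isQuasiUniform_mixin M & Nbhs M := {
  qentourage : set_system (M * M);
  qentourage_filter : Filter qentourage;
  qentourage_diagonal : forall A, qentourage A -> diagonal `<=` A;
  qentourage_split_ex :
    forall A, qentourage A -> exists2 B, qentourage B & B \; B `<=` A;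
  nbhs_qentourageE : nbhs = nbhs_ qentourage;
}.

#[short(type="quasiUniformType")]
HB.structure Definition QuasiUniform :=
  {T of Topological T & Nbhs_isQuasiUniform_mixin T}.

(* A quasi-uniformity on a bare type determines its topology. *)
HB.factory Record isQuasiUniform M & Choice M := {
  qentourage : set_system (M * M);
  qentourage_filter : Filter qentourage;
  qentourage_diagonal : forall A, qentourage A -> diagonal `<=` A;
  qentourage_split_ex :
    forall A, qentourage A -> exists2 B, qentourage B & B \; B `<=` A;
}.

HB.builders Context M & isQuasiUniform M.

HB.instance Definition _ := @hasNbhs.Build M (nbhs_ qentourage).

Let nbhs_filter (p : M) : ProperFilter (nbhs p).
Proof.
rewrite /nbhs/= nbhs_E; apply: filter_from_proper; last first.
  by move=> A entA; exists p; apply/mem_set; apply: qentourage_diagonal entA _ _.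
apply: filter_from_filter.
  by exists setT; exact: @filterT qentourage_filter.
move=> A B entA entB; exists (A `&` B); last by rewrite xsectionI.
exact: (@filterI _ _ qentourage_filter).
Qed.

Let nbhs_singleton (p : M) A : nbhs p A -> A p.
Proof.
move=> [B entB sBpA].
by apply/sBpA/mem_set; exact: qentourage_diagonal entB _ _.
Qed.

Let nbhs_nbhs (p : M) A : nbhs p A -> nbhs p (nbhs^~ A).
Proof.
move=> [B entB sBpA].
have /qentourage_split_ex[C entC sC2B] := entB.
exists C => // q Cpq; exists C => // r Cqr.
by apply/sBpA/mem_set/sC2B; exists q; exact/set_mem.
Qed.

HB.instance Definition _ := Nbhs_isNbhsTopological.Build M
  nbhs_filter nbhs_singleton nbhs_nbhs.

HB.instance Definition _ := Nbhs_isQuasiUniform_mixin.Build M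
  qentourage_filter qentourage_diagonal qentourage_split_ex erefl.

HB.end.

Local Close Scope relation_scope.

(* As usual, a directed family is nonempty. *)
Definition directed_upward {R : realType} {X : Type}
    (D : set (X -> X -> R)) : Prop :=
  D !=set0 /\
  forall d1 d2, D d1 -> D d2 ->
    exists d, [/\ D d, forall x y, d1 x y <= d x y
                     & forall x y, d2 x y <= d x y].

Definition F_quasi_gauge {R : realType} {X : Type}
    (D : set (X -> X -> R)) : Prop :=
  [/\ directed_upward D,
      forall d, D d -> forall x y, 0 <= d x y /\ d x x = 0
    & forall d, D d -> exists d', [/\ D d',
        forall x y, d x y <= d' x y
      & forall x y z, d x y <= d' x z + d' z y]].

(* All supersets of the sets V_{d, e}. *)
Definition gauge_quasi_uniformity {R : realType} {X : Type}
    (D : set (X -> X -> R)) : set_system (X * X) :=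
  filter_from [set de : (X -> X -> R) * R | D de.1 /\ 0 < de.2]
              (fun de => [set xy | de.1 xy.1 xy.2 < de.2]).

Definition right_K_cauchy {X : quasiUniformType} (u : nat -> X) : Prop :=
  forall U : set (X * X), qentourage U ->
    exists N : nat, forall n k : nat, (N <= n)%N -> U (u (n + k)%N, u n).

Definition seq_right_K_complete (X : quasiUniformType) : Prop :=
  forall u : nat -> X, right_K_cauchy u -> exists x : X, u @ \oo --> x.

Definition seq_closed {X : topologicalType} (A : set X) : Prop :=
  forall (u : nat -> X) (x : X), (forall n, A (u n)) -> u @ \oo --> x -> A x.

Definition proper_fun {R : realType} {X : Type} (phi : X -> \bar R) : Prop :=
  [set x | (phi x < +oo)%E] !=set0.

Definition bounded_below {R : realType} {X : Type} (phi : X -> \bar R) : Prop :=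
  exists m : R, forall x, (m%:E <= phi x)%E.

Definition S_set {R : realType} {X : Type} (D : set (X -> X -> R))
    (phi : X -> \bar R) (x : X) : set X :=
  [set y | forall d, D d -> (phi y + (d y x)%:E <= phi x)%E].

(* Main.v *)
Require Import Defs.
From HB Require Import structures.
From mathcomp Require Import all_boot all_order all_algebra.
From mathcomp Require Import all_classical all_reals all_analysis.

(** The condition that [y] lies in [S_set D phi x] is a preorder whose lower
sections are the sets [S_set D phi x]: reflexivity is [d x x = 0], and
transitivity is the weakened triangle inequality (QF3), which costs nothing
because the condition is imposed for every gauge at once.

Everything rests on an Ekeland-type principle ([exists_S_set_minimal]): some
[z] is minimal for this preorder, in the strong sense that its section is
[[set z]].  Starting from a point of finite value, let [u n.+1] be a point of
the section of [u n] at which [phi] exceeds its infimum over that section by at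
most [1 / (n + 1)].  The sections of the [u n] decrease, so [phi] varies by at
most [1 / (n + 1)] between [u n.+1] and any point [y] below it, and the
inequality defining the section turns this into [d y (u n.+1) <= 1 / (n + 1)]
for every gauge at once ([gauge_le_gap]).  Applied to later terms of the
sequence this gives the right K-Cauchy property, hence a limit [z]; sequential
closedness puts [z] below every [u n].  A point [y] below [z] is again below
every [u n], so [phi z <= phi (u n.+1) <= phi y + 1 / (n + 1)] for all [n];
therefore [d y z = 0] for every gauge, and the T1 axiom forces [y = z].

Both claims follow by looking at [F z]: a value of [F] at [z] that lies below
[z] can only be [z]. *)

Set Implicit Arguments.
Unset Strict Implicit.
Unset Printing Implicit Defensive.

Import Order.TTheory GRing.Theory Num.Theory.
Import numFieldNormedType.Exports.

Local Open Scope classical_set_scope.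
Local Open Scope ring_scope.

Lemma S_set_refl (R : realType) (X : Type) (D : set (X -> X -> R))
    (phi : X -> \bar R) (x : X) :
  F_quasi_gauge D -> S_set D phi x x.
Proof. by move=> [_ Dge0 _] d /Dge0/(_ x x)[_ ->]; rewrite adde0. Qed.

Lemma S_set_trans (R : realType) (X : Type) (D : set (X -> X -> R))
    (phi : X -> \bar R) (x y z : X) :
  F_quasi_gauge D -> S_set D phi y z -> S_set D phi x y -> S_set D phi x z.
Proof.
move=> [_ _ Dtri] zy yx d /Dtri[d' [Dd' _ tri]].
apply: le_trans (yx _ Dd'); apply: le_trans (leeD2r _ (zy _ Dd')).
by rewrite -addeA leeD2l// -EFinD lee_fin.
Qed.

Lemma S_set_le (R : realType) (X : Type) (D : set (X -> X -> R))
    (phi : X -> \bar R) (x y : X) :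
  F_quasi_gauge D -> S_set D phi x y -> (phi y <= phi x)%E.
Proof.
move=> [[[d Dd] _] Dge0 _] /(_ _ Dd); apply: le_trans.
by rewrite leeDl// lee_fin; case: (Dge0 _ Dd y x).
Qed.

(** The inequality defining the section of [x] bounds all the gauges by the drop
of [phi]; this is how control of [phi] becomes control of the
quasi-uniformity. *)
Lemma gauge_le_gap (R : realType) (X : Type) (D : set (X -> X -> R))
    (phi : X -> \bar R) (x y : X) (e : R) :
  phi y \is a fin_num -> S_set D phi x y -> (phi x <= phi y + e%:E)%E ->
  forall d, D d -> d y x <= e.
Proof.
move=> yfin yx xe d /yx /le_trans/(_ xe).
by rewrite leeD2lE// lee_fin.
Qed.

(** Infinite values are allowed, even [phi] identically infinite on [A], where
any point works: the minimizing chain can then be built by a choice function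
defined at every point of [X], with no invariant to carry along. *)
Lemma exists_near_minimum (R : realType) (X : Type) (phi : X -> \bar R)
    (A : set X) (e : R) :
  bounded_below phi -> A !=set0 -> 0 < e ->
  exists2 a, A a & forall y, A y -> (phi a <= phi y + e%:E)%E.
Proof.
move=> [m phim] [a Aa] e0; set I := ereal_inf (phi @` A).
have IA y : A y -> (I <= phi y)%E by move=> Ay; apply: ereal_inf_lbound; exists y.
have mI : (m%:E <= I)%E by apply: le_ereal_inf_tmp => _ [y _ <-]; exact: phim.
have [Ioo|Ifin] := eqVneq I +oo%E.
  exists a => // y /IA; rewrite Ioo leye_eq => /eqP ->.
  by rewrite addye ?leey// ltNye.
have {}Ifin : I \is a fin_num.
  by rewrite fin_numE Ifin andbT gt_eqF// (lt_le_trans _ mI)// ltNyr.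
have [_ [b Ab <-] bI] := lb_ereal_inf_adherent e0 Ifin.
exists b => // y /IA Iy; apply: (le_trans (ltW bI)); exact: leeD2r.
Qed.

Lemma exists_minimizing_chain (R : realType) (X : Type)
    (D : set (X -> X -> R)) (phi : X -> \bar R) (x0 : X) :
  F_quasi_gauge D -> bounded_below phi ->
  exists u : nat -> X, [/\ u 0%N = x0,
    forall n, S_set D phi (u n) (u n.+1)
  & forall n y, S_set D phi (u n) y -> (phi (u n.+1) <= phi y + n.+1%:R^-1%:E)%E].
Proof.
move=> hD phib.
have next (nx : nat * X) : exists a, S_set D phi nx.2 a /\
    forall y, S_set D phi nx.2 y -> (phi a <= phi y + nx.1.+1%:R^-1%:E)%E.
  have [||a] := @exists_near_minimum R X phi (S_set D phi nx.2) nx.1.+1%:R^-1 phib.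
  - by exists nx.2; exact: S_set_refl.
  - by rewrite invr_gt0 ltr0n.
  - by move=> ? ?; exists a.
have [g gP] := choice next.
pose u := fix u n := if n is k.+1 then g (k, u k) else x0.
by exists u; split => // n; have [] := gP (n, u n).
Qed.

(** The hypothesis puts [z] in every basic neighbourhood of [y].  The one-sided
value [d y z] suffices, although gauges are not symmetric, because the T1 axiom
gives an open set around [y] that avoids [z]. *)
Lemma gauge_separated (R : realType) (X : quasiUniformType)
    (D : set (X -> X -> R)) (y z : X) :
  @qentourage X = gauge_quasi_uniformity D -> accessible_space X ->
  (forall d, D d -> d y z <= 0) -> y = z.
Proof.
move=> hU T1 dyz; apply/eqP/negP => /negP /T1[A [oA /set_mem Ay /set_mem nAz]].
apply: nAz; have : nbhs y A by exact: open_nbhs_nbhs.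
rewrite nbhs_qentourageE => -[U]; rewrite hU => -[[d e] [/= Dd e0] dU]; apply.
by apply/mem_set/dU => /=; exact: le_lt_trans (dyz d Dd) e0.
Qed.

(** The Ekeland-type variational principle in its preorder form, and the common
source of the fixed-point and stationary-point results. *)
Lemma exists_S_set_minimal (R : realType) (X : quasiUniformType)
    (D : set (X -> X -> R)) (phi : X -> \bar R) :
  F_quasi_gauge D -> @qentourage X = gauge_quasi_uniformity D ->
  (forall x, (-oo < phi x)%E) -> proper_fun phi -> bounded_below phi ->
  (forall x, seq_closed (S_set D phi x)) ->
  seq_right_K_complete X -> accessible_space X ->
  exists z, forall y, S_set D phi z y -> y = z.
Proof.
move=> hD hU phiNy [x0 phix0] phib Scl Xc T1.
have [u [u0 uS umin]] := exists_minimizing_chain x0 hD phib.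
have uSk n k : S_set D phi (u n) (u (n + k)%N).
  elim: k => [|k IH]; first by rewrite addn0; exact: S_set_refl.
  by rewrite addnS; exact: S_set_trans (uS _) IH.
have below_fin n y : S_set D phi (u n) y -> phi y \is a fin_num.
  move=> yn; rewrite fin_numE gt_eqF//= lt_eqF//.
  apply: le_lt_trans phix0; rewrite -u0; apply: (S_set_le hD).
  exact: S_set_trans yn (uSk 0%N n).
have /Xc[z uz] : right_K_cauchy u.
  move=> U; rewrite hU => -[[d e] [/= Dd e0] dU].
  have [N _ Ne] := near_infty_natSinv_lt (PosNum e0).
  (* the estimate for [u n] comes from its predecessor, hence the successor *)
  exists N.+1 => -[//|n] k Nn; apply: dU => /=.
  apply: le_lt_trans (Ne n Nn); apply: gauge_le_gap (uSk n.+1 k) _ _ Dd.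
    exact: below_fin (uSk _ _).
  by apply: umin; rewrite addSnnS; exact: uSk.
have zS n : S_set D phi (u n) z.
  apply: (Scl _ (u \o addn n)); first exact: uSk.
  exact: cvg_comp (cvg_addnl n) uz.
exists z => y yz; apply: (gauge_separated hU T1).
have yS n : S_set D phi (u n) y by exact: S_set_trans yz (zS n).
have yfin := below_fin _ _ (yS 0%N).
apply: (gauge_le_gap yfin yz); apply/lee_addgt0Pr => e e0; rewrite adde0.
have [N _ /(_ N (leqnn N)) Ne] := near_infty_natSinv_lt (PosNum e0).
apply: (le_trans (S_set_le hD (zS N.+1))); apply: (le_trans (umin _ _ (yS N))).
by rewrite leeD2l// lee_fin ltW.
Qed.

Theorem theorem4p10 (R : realType) (X : quasiUniformType)
    (D : set (X -> X -> R)) (phi : X -> \bar R) (F : X -> set X)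
    (hD : F_quasi_gauge D)
    (hUD : @qentourage X = gauge_quasi_uniformity D)
    (phi_gtNy : forall x, (-oo < phi x)%E)
    (phi_proper : proper_fun phi)
    (phi_bounded_below : bounded_below phi)
    (S_closed : forall x, seq_closed (S_set D phi x))
    (X_complete : seq_right_K_complete X)
    (X_T1 : accessible_space X)
    (F_nonempty : forall x, F x !=set0) :
  ((forall x, exists2 y, F x y &
      forall d, D d -> (phi y + (d y x)%:E <= phi x)%E) ->
    exists z, F z z) /\
  ((forall x y d, F x y -> D d -> (phi y + (d y x)%:E <= phi x)%E) ->
    exists z, F z = [set z]).
Proof.
have [z zmin] := exists_S_set_minimal hD hUD phi_gtNy phi_proper
  phi_bounded_below S_closed X_complete X_T1.
split=> [FS|FS]; exists z.
  by have [y Fy /zmin yz] := FS z; rewrite -{2}yz.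
have Fz y : F z y -> y = z by move=> Fy; apply: zmin => d; exact: FS.
apply/seteqP; split=> [y /Fz //|_ ->].
by have [y Fy] := F_nonempty z; rewrite -{2}(Fz y Fy).
Qed.
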